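(* Suppose $\Sigma_0\neq\Sigma$ and $\beta_0=\beta$ (deterministic signal). Let $\mathscr R(\lambda,\phi)$ be the deterministic risk equivalent defined in the context and let $\lambda^*\in\arg\min_{\lambda\ge\lambda_{\min}(\phi)}\mathscr R(\lambda,\phi)$. (1) (Underparameterized) If $\phi<1$, then $\lambda^*\ge0$. (2) (Overparameterized) If $\phi>1$ and $\Sigma_0=I$ (the case of the estimation risk), then $\lambda^*\ge0$. (3) (Overparameterized) If $\phi>1$, $\Sigma=I$ and, with $B=\beta\beta^\top$, $$\overline{\mathrm{tr}}[\Sigma_0B]>\overline{\mathrm{tr}}[\Sigma_0]\left(\overline{\mathrm{tr}}[B]+\frac{(1+\mu(0,\phi))^3}{\mu(0,\phi)^3}\sigma^2\right),$$ then $\lambda^*<0$.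
   Context: Notation: $\overline{\mathrm{tr}}[A]=\mathrm{tr}[A]/p$ for $A\in\mathbb R^{p\times p}$. Parameters: $\Sigma,\Sigma_0\in\mathbb R^{p\times p}$ are deterministic symmetric matrices with eigenvalues bounded away from $0$ and $+\infty$ (uniformly in $p$), the feature covariances of the train and test distributions; $\beta,\beta_0\in\mathbb R^p$ are the $L_2$ linear projection coefficients of the train and test responses on the features; $\sigma^2,\sigma_0^2\ge 0$ are the corresponding noise variances; $\phi\in(0,\infty)$ is the limit of $p/n$. Let $r_{\min}$ be the smallest eigenvalue of $\Sigma$. Let $\mu_{\min}>-r_{\min}$ be the unique solution of $1=\phi\,\overline{\mathrm{tr}}[\Sigma^2(\Sigma+\mu_{\min}I)^{-2}]$, and let $\lambda_{\min}(\phi)=\mu_{\min}-\phi\,\overline{\mathrm{tr}}[\mu_{\min}\Sigma(\Sigma+\mu_{\min}I)^{-1}]$. For $\lambda>\lambda_{\min}(\phi)$, $\mu=\mu(\lambda,\phi)$ is the unique solution with $\mu>\mu_{\min}$ of $\mu=\lambda+\phi\,\overline{\mathrm{tr}}[\mu\Sigma(\Sigma+\mu I)^{-1}]$, and $$\tilde v=\frac{\phi\,\overline{\mathrm{tr}}[\Sigma_0\Sigma(\Sigma+\mu I)^{-2}]}{1-\phi\,\overline{\mathrm{tr}}[\Sigma^2(\Sigma+\mu I)^{-2}]}.$$ The deterministic equivalent of the ridge prediction risk is $\mathscr R(\lambda,\phi)=\mathscr B+\mathscr V+\mathscr S+\kappa^2$ with $\mathscr B=\mu^2\beta^\top(\Sigma+\mu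 I)^{-1}(\tilde v\Sigma+\Sigma_0)(\Sigma+\mu I)^{-1}\beta$, $\mathscr V=\sigma^2\tilde v$, $\mathscr S=2\mu\,\beta^\top(\Sigma+\mu I)^{-1}\Sigma_0(\beta_0-\beta)$, $\kappa^2=(\beta_0-\beta)^\top\Sigma_0(\beta_0-\beta)+\sigma_0^2$. The minimization is over the extended reals (values at $\lambda=\lambda_{\min}(\phi)$ and $\lambda=+\infty$ are understood as limits, possibly $+\infty$); if there are several minimizers, the assertion about $\lambda^*$ holds for any of them.
   Formalization: Parts (1) and (2) additionally assume that β ≠ 0 or σ² > 0; if β = 0 and σ² = 0 the risk is the constant σ₀², so every λ ≥ λ_min(φ), including negative ones, is a minimizer and the claim fails. *)

(* Defs.v *)
From HB Require Import structures.
From mathcomp Require Import all_boot all_order all_algebra.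
From mathcomp Require Import all_classical all_reals all_analysis.

Set Implicit Arguments.
Unset Strict Implicit.
Unset Printing Implicit Defensive.

Import Order.TTheory GRing.Theory Num.Theory.
Import numFieldNormedType.Exports.

Local Open Scope classical_set_scope.
Local Open Scope ring_scope.

Definition trbar (R : realType) (p : nat) (A : 'M[R]_p) : R := \tr A / p%:R.

Definition spectrum_in (R : realType) (p : nat) (A : 'M[R]_p) (c C : R) : Prop :=
  forall a : R, eigenvalue A a -> c <= a <= C.

(* The spectrum of a symmetric A is finite, and nonempty when p > 0, so the
   infimum is the smallest eigenvalue. *)
Definition rmin (R : realType) (p : nat) (A : 'M[R]_p) : R :=
  inf [set a : R | eigenvalue A a].

(* invmx is the identity on singular matrices; S + m I is invertible whenever
   m > - rmin S, which is the only range of m in use below. *)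
Definition resolvent (R : realType) (p : nat) (S : 'M[R]_p) (m : R) : 'M[R]_p :=
  invmx (S + m%:M).

(* In mu_min and mu, xget selects the unique element of the set. *)
Definition mu_min (R : realType) (p : nat) (S : 'M[R]_p) (phi : R) : R :=
  xget 0 [set m : R | - rmin S < m /\
                      1 = phi * trbar (S ^+ 2 *m resolvent S m ^+ 2)].

Definition lambda_min (R : realType) (p : nat) (S : 'M[R]_p) (phi : R) : R :=
  mu_min S phi
  - phi * trbar (mu_min S phi *: (S *m resolvent S (mu_min S phi))).

Definition mu (R : realType) (p : nat) (S : 'M[R]_p) (lambda phi : R) : R :=
  xget 0 [set m : R | mu_min S phi < m /\
                      m = lambda + phi * trbar (m *: (S *m resolvent S m))].

Definition vtilde (R : realType) (p : nat) (S S0 : 'M[R]_p) (lambda phi : R) : R :=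
  let G := resolvent S (mu S lambda phi) in
  phi * trbar (S0 *m S *m G ^+ 2) / (1 - phi * trbar (S ^+ 2 *m G ^+ 2)).

Definition bilin (R : realType) (p : nat) (u : 'cV[R]_p) (A : 'M[R]_p)
    (v : 'cV[R]_p) : R :=
  (u^T *m A *m v) 0 0.

Definition risk_bias (R : realType) (p : nat) (S S0 : 'M[R]_p)
    (beta : 'cV[R]_p) (lambda phi : R) : R :=
  let m := mu S lambda phi in
  let G := resolvent S m in
  m ^+ 2 * bilin beta (G *m (vtilde S S0 lambda phi *: S + S0) *m G) beta.

Definition risk_var (R : realType) (p : nat) (S S0 : 'M[R]_p)
    (sigma2 lambda phi : R) : R :=
  sigma2 * vtilde S S0 lambda phi.

Definition risk_shift (R : realType) (p : nat) (S S0 : 'M[R]_p)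
    (beta beta0 : 'cV[R]_p) (lambda phi : R) : R :=
  let m := mu S lambda phi in
  2 * m * bilin beta (resolvent S m *m S0) (beta0 - beta).

Definition risk_irr (R : realType) (p : nat) (S0 : 'M[R]_p)
    (beta beta0 : 'cV[R]_p) (sigma02 : R) : R :=
  bilin (beta0 - beta) S0 (beta0 - beta) + sigma02.

(* sigma2 and sigma02 are the noise variances themselves, not their roots. *)
Definition risk (R : realType) (p : nat) (S S0 : 'M[R]_p)
    (beta beta0 : 'cV[R]_p) (sigma2 sigma02 lambda phi : R) : R :=
  risk_bias S S0 beta lambda phi + risk_var S S0 sigma2 lambda phi
  + risk_shift S S0 beta beta0 lambda phi + risk_irr S0 beta beta0 sigma02.

(* The risk on [lambda_min, +oo], with its limits in \bar R at both endpoints;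
   the values below lambda_min, in particular at -oo, are irrelevant. *)
Definition risk_ext (R : realType) (p : nat) (S S0 : 'M[R]_p)
    (beta beta0 : 'cV[R]_p) (sigma2 sigma02 phi : R) (l : \bar R) : \bar R :=
  let f (x : R) : \bar R := (risk S S0 beta beta0 sigma2 sigma02 x phi)%:E in
  match l with
  | r%:E => if r == lambda_min S phi
            then lim (f x @[x --> (lambda_min S phi)^'+])
            else f r
  | +oo => lim (f x @[x --> +oo%R])
  | -oo => 0
  end%E.

Definition risk_argmin (R : realType) (p : nat) (S S0 : 'M[R]_p)
    (beta beta0 : 'cV[R]_p) (sigma2 sigma02 phi : R) : set (\bar R) :=
  let F := risk_ext S S0 beta beta0 sigma2 sigma02 phi in
  [set l | ((lambda_min S phi)%:E <= l)%E /\
    forall l' : \bar R, ((lambda_min S phi)%:E <= l')%E -> (F l <= F l')%E].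

(* Main.v *)
Require Import Defs.
From HB Require Import structures.
From mathcomp Require Import all_boot all_order all_algebra.
From mathcomp Require Import ring lra complex.
From mathcomp Require Import all_classical all_reals all_analysis.

Set Implicit Arguments.
Unset Strict Implicit.
Unset Printing Implicit Defensive.

Import Order.TTheory GRing.Theory Num.Theory.
Import numFieldNormedType.Exports.

Local Open Scope classical_set_scope.
Local Open Scope ring_scope.

(** In an orthonormal eigenbasis of [Sigma] every quantity is a function of
    [m = mu]: [lambda] becomes [fp_lambda m], strictly increasing for
    [m >= mu_min], the denominator of [vtilde] becomes its derivative
    [fp_slope m], and [vtilde] blows up at [mu_min], so that [lambda_min] is
    never a minimizer.

    When [phi < 1], [lambda = 0] corresponds to [m = 0], where the bias vanishes,
    while [vtilde] decreases with [m]; so every [m < 0] does strictly worse.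

    When [phi > 1] and [Sigma0 = I], write [n = mu 0] and [m < n].  The identity
    [(n s + m^2) / (s + m)^2 - n / (s + n) = s (n - m)^2 / ((s + m)^2 (s + n))],
    weighted by [s] and averaged over the spectrum, gives [m^2 vtilde(m) >= n];
    inserted in the bias, the same identity shows that it exceeds its value
    [n / (s + n)] at [n] in each eigendirection.

    When [Sigma = I], put [u = 1 / (1 + m)] and [r = 1 / phi].  The risk is a
    sum of three terms, the last two minimal at [u = r], i.e. at [lambda = 0],
    while the first, [eta (1 - u)^2] with [eta > 0] by hypothesis, is strictly
    decreasing; so a slightly larger [u] beats the whole range [0 <= u <= r]. *)

(** * Real symmetric matrices *)

Lemma row_dotE (R : rcfType) n (u v : 'rV[R]_n) :
  (u *m v^T) 0 0 = \sum_i u 0 i * v 0 i.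
Proof. by rewrite mxE; apply: eq_bigr => i _; rewrite mxE. Qed.

Lemma row_sqnorm_ge0 (R : rcfType) n (u : 'rV[R]_n) : 0 <= (u *m u^T) 0 0.
Proof. by rewrite row_dotE; apply: sumr_ge0 => i _; exact: sqr_ge0. Qed.

Lemma row_sqnorm_gt0 (R : rcfType) n (u : 'rV[R]_n) :
  u != 0 -> 0 < (u *m u^T) 0 0.
Proof.
move=> u0; rewrite lt_neqAle row_sqnorm_ge0 andbT eq_sym row_dotE.
apply: contra_neq u0; move/eqP.
rewrite psumr_eq0 => [/allP u0|i _]; last exact: sqr_ge0.
apply/rowP => i; rewrite mxE; apply/eqP.
by have := u0 i (mem_index_enum i); rewrite /= mulf_eq0 orbb.
Qed.

(** Over the complex closure an eigenvector exists; once its eigenvalue is shown to be real, its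
    real and imaginary parts satisfy the same equation, and one of them is nonzero. *)
Lemma symmetric_eigenvector (R : rcfType) n (A : 'M[R]_n.+1) :
  A^T = A -> exists2 v : 'rV[R]_n.+1, v *m v^T = 1%:M & exists a, v *m A = a *: v.
Proof.
move=> As.
have [v [v0 [a va]]] : exists v : 'rV[R]_n.+1, v != 0 /\ exists a, v *m A = a *: v.
  have [z /eigenvalueP[v vA v0]] :=
    eigenvalue_closed (map_mx (complex.real_complex R) A) (ltn0Sn n).
  pose x := map_mx (@complex.Re R) v; pose y := map_mx (@complex.Im R) v.
  have xA : x *m A = complex.Re z *: x - complex.Im z *: y.
    apply/rowP => j; move/rowP/(_ j): vA; rewrite !mxE => /(congr1 (@complex.Re R)).
    case: z (v 0 j) => z1 z2 [v1 v2] /= <-; rewrite raddf_sum; apply: eq_bigr => i _.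
    by rewrite !mxE; case: (v 0 i) => w1 w2 /=; rewrite mulr0 subr0.
  have yA : y *m A = complex.Im z *: x + complex.Re z *: y.
    apply/rowP => j; move/rowP/(_ j): vA {xA}; rewrite !mxE => /(congr1 (@complex.Im R)).
    case: z (v 0 j) => z1 z2 [v1 v2] /= vE; rewrite addrC -vE raddf_sum.
    apply: eq_bigr => i _.
    by rewrite !mxE; case: (v 0 i) => w1 w2 /=; rewrite mulr0 add0r.
  have xy0 : (x != 0) || (y != 0).
    rewrite -negb_and; apply: contra v0 => /andP[/eqP/rowP x0 /eqP/rowP y0].
    apply/eqP/rowP => i; move: (x0 i) (y0 i); rewrite !mxE.
    by case: (v 0 i) => ? ? /= -> ->.
  (* Symmetry of [A] forces the imaginary part of its eigenvalue to vanish. *)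
  have z0 : complex.Im z = 0.
    have /matrixP/(_ 0 0) : x *m A *m y^T = (y *m A *m x^T)^T.
      by rewrite !trmx_mul trmxK As mulmxA.
    have /matrixP/(_ 0 0) : x *m y^T = (y *m x^T)^T by rewrite !trmx_mul trmxK.
    rewrite xA yA !mulmxDl mulNmx -!scalemxAl.
    have := row_sqnorm_ge0 x; have := row_sqnorm_ge0 y.
    have : 0 < (x *m x^T) 0 0 + (y *m y^T) 0 0.
      case/orP: xy0 => /row_sqnorm_gt0 ?; first exact: ltr_wpDr (row_sqnorm_ge0 _) _.
      exact: ltr_wpDl (row_sqnorm_ge0 _) _.
    move: (x *m x^T) (y *m y^T) (x *m y^T) (y *m x^T) => xx yy xy yx.
    rewrite !mxE => lt0 _ _ ->  h.
    have /eqP : complex.Im z * (xx 0 0 + yy 0 0) = 0 by lra.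
    by rewrite mulf_eq0 (gt_eqF lt0) orbF => /eqP.
  move: xA yA; rewrite z0 !scale0r subr0 add0r => xA yA.
  by case/orP: xy0 => ?; [exists x | exists y]; split=> //; exists (complex.Re z).
have vv := row_sqnorm_gt0 v0.
exists ((Num.sqrt ((v *m v^T) 0 0))^-1 *: v); last first.
  by exists a; rewrite -scalemxAl va !scalerA mulrC.
rewrite linearZ -scalemxAl -scalemxAr scalerA -expr2 exprVn sqr_sqrtr ?ltW//.
by rewrite [v *m v^T]mx11_scalar mxE eqxx mulr1n scale_scalar_mx mulVf ?gt_eqF.
Qed.

(** Unless [v = e], [Q] is the Householder reflection along [e - v], which exchanges these two unit
    vectors. *)
Lemma orthogonal_row0 (R : rcfType) n (v : 'rV[R]_n.+1) : v *m v^T = 1%:M ->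
  exists2 Q : 'M[R]_n.+1, Q^T = Q /\ Q *m Q = 1%:M & delta_mx 0 0 *m Q = v.
Proof.
move=> vv; pose e : 'rV[R]_n.+1 := delta_mx 0 0.
have [->|ve] := eqVneq v e.
  by exists 1%:M; rewrite ?trmx1 ?mul1mx ?mulmx1.
have [u uE] : exists u, u = e - v by eexists.
have := @row_sqnorm_gt0 _ _ u; rewrite {1}uE subr_eq0 eq_sym => /(_ ve) uu.
have ee : e *m e^T = 1%:M.
  apply/matrixP => i j; rewrite !ord1 row_dotE (bigD1 0)//= big1 ?addr0 => [|k k0].
    by rewrite !mxE eqxx mulr1.
  by rewrite !mxE (negPf k0) andbF mul0r.
have ve_ev : v *m e^T = e *m v^T.
  by apply/matrixP => i j; rewrite !ord1 !row_dotE; apply: eq_bigr => k _; rewrite mulrC.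
pose k := (u *m u^T) 0 0.
have ukE : u *m u^T = k%:M by rewrite [LHS]mx11_scalar.
have euE : e *m u^T = (k / 2)%:M.
  have : e *m u^T = 2^-1 *: (u *m u^T).
    rewrite uE linearB /= !mulmxBl !mulmxBr ee vv ve_ev.
    apply/matrixP => i j; rewrite !ord1 !mxE; by field.
  by move=> ->; rewrite ukE scale_scalar_mx mulrC.
exists (1%:M - (2 / k) *: (u^T *m u)); last first.
  rewrite mulmxBr mulmx1 -scalemxAr mulmxA euE mul_scalar_mx scalerA.
  have -> : 2 / k * (k / 2) = 1 by field; rewrite gt_eqF.
  by rewrite scale1r uE opprB addrC subrK.
split; first by rewrite linearB linearZ /= trmx1 trmx_mul trmxK.
have Z : (u^T *m u) *m (u^T *m u) = k *: (u^T *m u).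
  by rewrite mulmxA -(mulmxA u^T u) ukE mul_mx_scalar -scalemxAl.
rewrite mulmxBl mul1mx mulmxBr mulmx1 -scalemxAl -scalemxAr Z !scalerA.
have -> : 2 / k * (2 / k) * k = 2 / k + 2 / k by field; rewrite gt_eqF.
by rewrite scalerDl opprB addrK subrK.
Qed.

(** Deflation: conjugation by the reflection makes [e] an eigenvector of [B]; by symmetry [B] is
    then block diagonal, and induction applies to its lower block. *)
Lemma symmetric_spectral (R : rcfType) n (A : 'M[R]_n) : A^T = A ->
  exists (P : 'M[R]_n) (s : 'rV[R]_n),
    P *m P^T = 1%:M /\ A = P^T *m diag_mx s *m P.
Proof.
elim: n A => [|n IHn] A As.
  by exists 1%:M, 0; split; apply/matrixP => - [].
have [v vv [a va]] := symmetric_eigenvector As.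
have [Q [Qs QQ] eQ] := orthogonal_row0 vv.
have [B BQ] : exists B : 'M[R]_(1 + n), B = Q *m A *m Q by eexists.
have Bs : B^T = B by rewrite BQ !trmx_mul Qs As mulmxA.
have eB : delta_mx 0 0 *m B = a *: (delta_mx 0 0 : 'rV_n.+1).
  rewrite BQ !mulmxA eQ va -scalemxAl; congr (_ *: _).
  by rewrite -eQ -mulmxA QQ mulmx1.
have B0 j : B 0 j = a *+ (j == 0).
  by move/rowP/(_ j): eB; rewrite -rowE !mxE eqxx mulr_natr.
have l0 : lshift n 0 = 0 :> 'I_(1 + n) by exact: val_inj.
have BE : B = block_mx a%:M 0 0 (drsubmx B).
  rewrite -[LHS]submxK; congr block_mx.
  - apply/matrixP => i j; rewrite !ord1 !mxE.
    by rewrite l0 B0.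
  - apply/matrixP => i j; rewrite !ord1 !mxE.
    by rewrite l0 B0.
  - apply/matrixP => i j; rewrite -Bs !ord1 !mxE.
    by rewrite l0 B0.
have [|P [s [PP PE]]] := IHn (drsubmx B); first by rewrite trmx_drsub Bs.
pose N : 'M[R]_(1 + n) := block_mx 1%:M 0 0 P.
pose d : 'rV[R]_(1 + n) := row_mx a%:M s.
have NN : N *m N^T = 1%:M.
  rewrite tr_block_mx !trmx0 trmx1 mulmx_block !(mulmx0, mul0mx, addr0, add0r).
  by rewrite mulmx1 PP -scalar_mx_block.
have BN : B = N^T *m diag_mx d *m N.
  rewrite {1}BE diag_mx_row tr_block_mx !trmx0 trmx1 !mulmx_block.
  rewrite !(mulmx0, mul0mx, addr0, add0r) mul1mx mulmx1 -PE.
  by congr block_mx; apply/matrixP => i j; rewrite !ord1 !mxE.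
exists (N *m Q), d; split.
  by rewrite trmx_mul Qs mulmxA -(mulmxA _ Q Q) QQ mulmx1.
rewrite trmx_mul Qs -[A]mul1mx -[_ *m A]mulmx1 -QQ -!(mulmxA Q) !mulmxA.
by rewrite -[in LHS](mulmxA Q Q) -(mulmxA Q _ Q) -BQ BN !mulmxA.
Qed.

(** * The fixed-point equation in the eigenbasis *)

Section FixedPoint.
Variables (R : realType) (p : nat) (s : 'I_p -> R) (w : R).
Hypotheses (p_gt0 : (0 < p)%N) (s_gt0 : forall i, 0 < s i) (w_gt0 : 0 < w).

(** Here [s] stands for the spectrum of [Sigma] and [w] for [phi / p]; the domain is the range
    [m > - rmin Sigma]. *)
Definition fp_dom (m : R) := forall i, 0 < s i + m.

Definition fp_lambda (m : R) : R := m - w * \sum_i m * (s i / (s i + m)).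

Definition fp_slope (m : R) : R := 1 - w * \sum_i (s i / (s i + m)) ^+ 2.

Lemma fp_domW x y : fp_dom x -> x <= y -> fp_dom y.
Proof. by move=> xd xy i; apply: lt_le_trans (xd i) _; rewrite lerD2l. Qed.

Lemma fp_dom0 : fp_dom 0. Proof. by move=> i; rewrite addr0. Qed.

Let ltr_sum_ord (F G : 'I_p -> R) :
  (forall i, F i < G i) -> \sum_i F i < \sum_i G i.
Proof.
move=> FG; apply: ltr_sum => //.
by apply/hasP; exists (Ordinal p_gt0); rewrite ?mem_index_enum.
Qed.

Lemma fp_slope_lt x y : fp_dom x -> x < y -> fp_slope x < fp_slope y.
Proof.
move=> xd xy; rewrite ltrD2l ltrN2 ltr_pM2l//; apply: ltr_sum_ord => i.
have yi := fp_domW xd (ltW xy) i; have xi := xd i.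
rewrite ltr_pXn2r// ?nnegrE; try exact/ltW/divr_gt0.
by rewrite ltr_pM2l// ltf_pV2 ?posrE// ltrD2l.
Qed.

(** Convexity: the chord involves [s^2 / ((s + x) (s + y))], which is smaller than the
    [s^2 / (s + x)^2] of the tangent at [x]. *)
Lemma fp_lambda_slope x y : fp_dom x -> x < y ->
  (y - x) * fp_slope x < fp_lambda y - fp_lambda x.
Proof.
move=> xd xy; have yd := fp_domW xd (ltW xy).
have E : \sum_i y * (s i / (s i + y)) = \sum_i x * (s i / (s i + x)) +
    (y - x) * \sum_i s i ^+ 2 / ((s i + x) * (s i + y)).
  rewrite mulr_sumr -big_split; apply: eq_bigr => i _ /=.
  by field; rewrite !gt_eqF.
have -> : fp_lambda y - fp_lambda x =
    (y - x) * (1 - w * \sum_i s i ^+ 2 / ((s i + x) * (s i + y))).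
  by rewrite /fp_lambda E; ring.
rewrite ltr_pM2l ?subr_gt0// ltrD2l ltrN2 ltr_pM2l//; apply: ltr_sum_ord => i.
rewrite expr_div_n ltr_pM2l ?exprn_gt0// ltf_pV2 ?posrE ?exprn_gt0 ?mulr_gt0//.
by rewrite expr2 ltr_pM2l// ltrD2l.
Qed.

Lemma fp_lambda_lt x y : fp_dom x -> 0 <= fp_slope x -> x < y ->
  fp_lambda x < fp_lambda y.
Proof.
move=> xd x0 xy; rewrite -subr_gt0; apply: le_lt_trans (fp_lambda_slope xd xy).
by rewrite mulr_ge0// subr_ge0 ltW.
Qed.

Lemma fp_lambda0 : fp_lambda 0 = 0.
Proof. by rewrite /fp_lambda big1 ?mulr0 ?subr0// => i _; rewrite mul0r. Qed.

Lemma fp_slope0 : fp_slope 0 = 1 - w * p%:R.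
Proof.
rewrite /fp_slope; congr (_ - _ * _); rewrite -[p in RHS]card_ord -sumr_const.
by apply: eq_bigr => i _; rewrite addr0 divff ?gt_eqF// expr1n.
Qed.

Let ratio_cvg m i : fp_dom m -> s i / (s i + x) @[x --> m] --> s i / (s i + m).
Proof.
move=> md; apply: cvgM; first exact: cvg_cst.
apply: cvgV; first by rewrite gt_eqF.
by apply: cvgD; [exact: cvg_cst|exact: cvg_id].
Qed.

Lemma fp_slope_continuous m : fp_dom m -> {for m, continuous fp_slope}.
Proof.
move=> md; apply: cvgB; first exact: cvg_cst.
apply: cvgM; first exact: cvg_cst.
apply: cvg_big => [|i _]; first exact: add_continuous.
rewrite expr2; under eq_cvg do rewrite expr2.
by apply: cvgM; exact: ratio_cvg.
Qed.

Lemma fp_lambda_continuous m : fp_dom m -> {for m, continuous fp_lambda}.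
Proof.
move=> md; apply: cvgB; first exact: cvg_id.
apply: cvgM; first exact: cvg_cst.
apply: cvg_big => [|i _]; first exact: add_continuous.
by apply: cvgM; [exact: cvg_id|exact: ratio_cvg].
Qed.

Let IVT_dom (f : R -> R) x y l : fp_dom x -> x <= y ->
  (forall m, fp_dom m -> {for m, continuous f}) -> f x <= l <= f y ->
  exists m, [/\ x <= m, fp_dom m & f m = l].
Proof.
move=> xd xy fc /andP[fx fy].
have [||m] := @IVT R f x y l xy.
- apply: continuous_in_subspaceT => m /set_mem/=; rewrite in_itv/= => /andP[xm _].
  by apply: fc; exact: fp_domW xm.
- by rewrite ge_min fx/= le_max fy orbT.
- rewrite in_itv/= => /andP[xm _] fm; exists m; split=> //; exact: fp_domW xm.
Qed.

Let sum_s_gt0 : 0 < \sum_i s i.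
Proof.
by have := @ltr_sum_ord (fun=> 0) s s_gt0; rewrite big1.
Qed.

Lemma fp_slope_root : exists m, fp_dom m /\ fp_slope m = 0.
Proof.
pose i0 := Ordinal p_gt0.
case: (@arg_minP _ _ _ i0 predT s isT) => k _ kmin.
(* The left end [x] is such that [s k + x = a * s k] at the smallest eigenvalue: that term alone
   gives [w / a^2 >= 1], as [a^2 <= a <= w]. *)
pose a := Num.min 1 w.
have a0 : 0 < a by rewrite lt_min ltr01 w_gt0.
have a1 : a <= 1 by rewrite ge_min lexx.
have aw : a <= w by rewrite ge_min lexx orbT.
pose x := a * s k - s k.
have xd : fp_dom x.
  move=> i; rewrite /x addrCA; apply: (lt_le_trans (mulr_gt0 a0 (s_gt0 k))).
  by rewrite lerDl subr_ge0 kmin.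
pose y := w * \sum_i s i.
have y0 : 0 < y by rewrite mulr_gt0.
have xy : x <= y.
  apply: le_trans (ltW y0); rewrite /x subr_le0 -[leRHS]mul1r.
  by rewrite ler_wpM2r// ltW.
have yd : fp_dom y by exact: fp_domW xd xy.
have [||m [_ ? ?]] := @IVT_dom fp_slope x y 0 xd xy; last by exists m.
  by move=> m; exact: fp_slope_continuous.
apply/andP; split.
  rewrite subr_le0 (bigD1 k)//= mulrDr.
  rewrite -[leLHS]addr0 lerD//; last first.
    by apply: mulr_ge0; [exact: ltW|apply: sumr_ge0 => i _; exact: sqr_ge0].
  have -> : s k / (s k + x) = a^-1.
    by rewrite /x addrC subrK; field; rewrite !gt_eqF.
  rewrite exprVn -[_ * _]/(_ / _) ler_pdivlMr ?exprn_gt0// mul1r.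
  by apply: le_trans aw; rewrite expr2 ler_piMl// ltW.
rewrite subr_ge0 -[leRHS](@divff _ y) ?gt_eqF// {2}/y -mulrA ler_pM2l//.
rewrite mulr_suml; apply: ler_sum => i _.
have si := s_gt0 i; have yi := yd i.
rewrite expr2; apply: (@le_trans _ _ (s i / (s i + y))).
  by rewrite ler_piMl ?ltW ?divr_gt0// ltr_pdivrMr// mul1r ltrDl.
by rewrite ler_pM2l// lef_pV2 ?posrE// lerDr ltW.
Qed.

Lemma fp_lambda_surj x l : fp_dom x -> fp_lambda x < l ->
  exists2 m, x < m & fp_lambda m = l.
Proof.
(* For [m >= 0] the terms [m s / (s + m)] are at most [s], so [fp_lambda y] is at least
   [y - w * \sum_i s i], hence at least [l]. *)
move=> xd xl; pose y := Num.max x (Num.max 0 (l + w * \sum_i s i)).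
have xy : x <= y by rewrite le_max lexx.
have y0 : 0 <= y by rewrite !le_max lexx orbT.
have ly : l + w * \sum_i s i <= y by rewrite !le_max lexx !orbT.
have yd := fp_domW xd xy.
have [||m [xm _ ml]] := @IVT_dom fp_lambda x y l xd xy.
- by move=> m; exact: fp_lambda_continuous.
- rewrite (ltW xl)/= lerBrDr; apply: le_trans ly; rewrite lerD2l ler_pM2l//.
  apply: ler_sum => i _; rewrite mulrCA; apply: ler_piMr; first exact: ltW.
  by rewrite ler_pdivrMr// mul1r lerDr ltW.
- exists m => //; rewrite lt_neqAle xm andbT; apply: contraTneq xl => ->.
  by rewrite ml ltxx.
Qed.

Lemma fp_slope_small x e : fp_dom x -> fp_slope x = 0 -> 0 < e ->
  exists2 y, x < y & forall m, x < m < y -> 0 < fp_slope m < e.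
Proof.
move=> xd x0 e0.
have /cvgrPdist_lt/(_ _ e0)/nbhs_ballP[d /= d0 dP] := fp_slope_continuous xd.
exists (x + d) => [|m /andP[xm my]]; first by rewrite ltrDl.
have sm : 0 < fp_slope m by rewrite -x0 fp_slope_lt.
rewrite sm; have := dP m; rewrite /= x0 sub0r normrN gtr0_norm//; apply.
by rewrite /ball/= distrC gtr0_norm ?subr_gt0// ltrBlDl.
Qed.

(** For [x < 0] this is monotonicity up to [0]. For [x > 0], [fp_lambda x] is [x] times
    [1 - w sum s / (s + x)], and each ratio exceeds its square, so this factor is below
    [fp_slope x = 0]. *)
Lemma fp_lambda_root_slope x : fp_dom x -> fp_slope x = 0 -> x != 0 -> fp_lambda x < 0.
Proof.
move=> xd x0; rewrite neq_lt => /orP[xlt|xgt].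
  by rewrite -fp_lambda0 fp_lambda_lt// x0.
rewrite /fp_lambda -mulr_sumr mulrCA -{1}[x]mulr1 -mulrBr pmulr_rlt0//.
rewrite -[ltRHS]x0 ltrD2l ltrN2 ltr_pM2l//; apply: ltr_sum_ord => i.
by rewrite expr2 gtr_pMl ?divr_gt0// ltr_pdivrMr// mul1r ltrDl.
Qed.

End FixedPoint.

(** * Comparison of risks in the eigenbasis *)

Section ScalarRisk.
Variables (R : realType) (p : nat) (s t b : 'I_p -> R) (w sg : R).
Hypotheses (p_gt0 : (0 < p)%N) (s_gt0 : forall i, 0 < s i) (w_gt0 : 0 < w).
Hypotheses (t_gt0 : forall i, 0 < t i) (b_ge0 : forall i, 0 <= b i).
Hypothesis sg_ge0 : 0 <= sg.

(** With [c] the diagonal of [Sigma0] in the eigenbasis this is, up to [w], the numerator of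
    [vtilde]; with [c] the squared coordinates of [beta] it is the [Sigma] part of the bias. *)
Definition wsum (c : 'I_p -> R) (m : R) : R := \sum_i c i * (s i / (s i + m) ^+ 2).

Definition fp_v (m : R) : R := w * wsum t m / fp_slope s w m.

Lemma wsum_ge0 c m : (forall i, 0 <= c i) -> 0 <= wsum c m.
Proof.
by move=> c0; apply: sumr_ge0 => i _; rewrite mulr_ge0// divr_ge0 ?sqr_ge0// ltW.
Qed.

Lemma wsum_gt0 c m : (forall i, 0 <= c i) -> (exists i, 0 < c i) ->
  fp_dom s m -> 0 < wsum c m.
Proof.
move=> c0 [i ci] md; rewrite /wsum (bigD1 i)//= ltr_pwDl//.
  by rewrite mulr_gt0// divr_gt0// exprn_gt0.
by apply: sumr_ge0 => j _; rewrite mulr_ge0// divr_ge0 ?sqr_ge0// ltW.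
Qed.

Lemma wsum_le c x y : (forall i, 0 <= c i) -> fp_dom s x -> x <= y ->
  wsum c y <= wsum c x.
Proof.
move=> c0 xd xy; have yd := fp_domW xd xy.
apply: ler_sum => i _; apply: ler_wpM2l => //.
rewrite ler_pM2l// lef_pV2 ?posrE ?exprn_gt0//.
by rewrite ler_pXn2r// ?nnegrE ?(ltW (xd i)) ?(ltW (yd i))// lerD2l.
Qed.

Let t_ge0 i : 0 <= t i. Proof. exact: ltW. Qed.
Let ex_t : exists i, 0 < t i. Proof. by exists (Ordinal p_gt0). Qed.

Lemma fp_v_gt0 m : fp_dom s m -> 0 < fp_slope s w m -> 0 < fp_v m.
Proof. by move=> md m0; rewrite divr_gt0// mulr_gt0// wsum_gt0. Qed.

Lemma fp_v_lt x y : fp_dom s x -> 0 < fp_slope s w x -> x < y -> fp_v y < fp_v x.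
Proof.
move=> xd x0 xy; have yd := fp_domW xd (ltW xy).
have xys := fp_slope_lt p_gt0 s_gt0 w_gt0 xd xy.
rewrite /fp_v; apply: (@le_lt_trans _ _ (w * wsum t x / fp_slope s w y)).
  by rewrite ler_wpM2r ?invr_ge0 ?(ltW (lt_trans x0 xys))// ler_pM2l// wsum_le// ltW.
rewrite ltr_pM2l ?mulr_gt0 ?wsum_gt0// ltf_pV2 ?posrE//; exact: lt_trans xys.
Qed.

Hypothesis nontrivial : (exists i, 0 < b i) \/ 0 < sg.

(** The denominator of [fp_v] vanishes at [x], while its factor [m^2 wsum b m + sg] stays above a
    positive constant; [x != 0] keeps [m^2] away from zero. *)
Lemma fp_v_blowup x A : fp_dom s x -> fp_slope s w x = 0 -> x != 0 ->
  exists2 y, x < y & forall m, x < m < y ->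
    A <= m ^+ 2 * (fp_v m * wsum b m) + sg * fp_v m.
Proof.
move=> xd xs x0.
have [y1 xy1 y1P] : exists2 y, x < y & forall m, x < m < y -> x ^+ 2 / 4 <= m ^+ 2.
  move: x0; rewrite neq_lt => /orP[xlt|xgt].
    by exists (x / 2) => [|m /andP[? ?]]; [lra|nra].
  by exists (x + 1) => [|m /andP[? ?]]; [lra|nra].
have yd := fp_domW xd (ltW xy1).
have x2 : 0 < x ^+ 2 / 4 by rewrite divr_gt0// exprn_even_gt0.
(* [k] bounds that factor from below and [n] the numerator of [fp_v], uniformly on [x < m < y1]. *)
pose k := x ^+ 2 / 4 * wsum b y1 + sg.
have k0 : 0 < k.
  case: nontrivial => [ib|sg0]; last first.
    by apply: ltr_wpDl => //; apply: mulr_ge0; [exact: ltW|exact: wsum_ge0].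
  by apply: ltr_wpDr => //; rewrite mulr_gt0// wsum_gt0.
pose n := w * wsum t y1.
have n0 : 0 < n by rewrite mulr_gt0// wsum_gt0.
have A0 : 0 < `|A| + 1 by rewrite ltr_wpDl.
have e0 : 0 < n * k / (`|A| + 1) by rewrite divr_gt0// mulr_gt0.
have [y2 xy2 y2P] := fp_slope_small p_gt0 s_gt0 w_gt0 xd xs e0.
exists (Num.min y1 y2) => [|m /andP[xm]]; first by rewrite lt_min xy1.
rewrite lt_min => /andP[my1 my2].
have md := fp_domW xd (ltW xm).
have /andP[sm0 sme] : 0 < fp_slope s w m < n * k / (`|A| + 1) by apply: y2P; rewrite xm.
have -> : m ^+ 2 * (fp_v m * wsum b m) + sg * fp_v m =
  fp_v m * (m ^+ 2 * wsum b m + sg) by ring.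
apply: (@le_trans _ _ (n / fp_slope s w m * k)); last first.
  apply: ler_pM; [exact/ltW/divr_gt0|exact: ltW| |].
    by rewrite ler_pM2r ?invr_gt0// ler_pM2l// wsum_le// ltW.
  rewrite lerD2r; apply: ler_pM; [exact: ltW|exact: wsum_ge0| |].
    by apply: y1P; rewrite xm.
  by rewrite wsum_le// ltW.
rewrite mulrAC ler_pdivlMr//; apply: le_trans (_ : (`|A| + 1) * fp_slope s w m <= _).
  by rewrite ler_pM2r// ler_wpDr// ler_norm.
by rewrite mulrC -ler_pdivlMr// ltW.
Qed.

End ScalarRisk.

(** * Estimation risk for [phi > 1] *)

Section EstimationRisk.
Variables (R : realType) (p : nat) (s b : 'I_p -> R) (w sg : R).
Hypotheses (p_gt0 : (0 < p)%N) (s_gt0 : forall i, 0 < s i) (w_gt0 : 0 < w).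
Hypotheses (b_ge0 : forall i, 0 <= b i) (sg_ge0 : 0 <= sg).
Hypothesis nontrivial : (exists i, 0 < b i) \/ 0 < sg.

Let v := fp_v s (fun=> 1) w.

(** The explicit sum is the squared norm of the resolvent applied to [beta]; the constant [sigma02]
    is left out. *)
Definition est_risk (m : R) : R :=
  m ^+ 2 * (v m * wsum s b m + \sum_i b i * ((s i + m) ^+ 2)^-1) + sg * v m.

Section Comparison.
Variables (n m : R).
Hypotheses (m_gt0 : 0 < m) (mn : m < n) (n_root : fp_lambda s w n = 0).
Hypothesis m_slope : 0 < fp_slope s w m.

Let n_gt0 : 0 < n. Proof. exact: lt_trans mn. Qed.
Let smP i : 0 < s i + m. Proof. exact: addr_gt0. Qed.
Let snP i : 0 < s i + n. Proof. exact: addr_gt0. Qed.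

Let n_rootE : w * \sum_i s i / (s i + n) = 1.
Proof.
move/eqP: n_root; rewrite /fp_lambda -mulr_sumr mulrCA -{1}[n]mulr1 -mulrBr.
by rewrite mulf_eq0 gt_eqF//= subr_eq0 => /eqP.
Qed.

Let key i : (n * s i + m ^+ 2) / (s i + m) ^+ 2 =
  n / (s i + n) + s i * (n - m) ^+ 2 / ((s i + m) ^+ 2 * (s i + n)).
Proof. by field; rewrite !gt_eqF. Qed.

Let key_gt i : n / (s i + n) < (n * s i + m ^+ 2) / (s i + m) ^+ 2.
Proof.
rewrite key ltrDl divr_gt0// mulr_gt0// exprn_gt0//.
by rewrite subr_gt0.
Qed.

(** Replacing the [1] in [fp_slope] by [w sum s / (s + n)] factors the slope as [n] times the
    numerator of [v n]. *)
Let v_n : v n = n^-1.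
Proof.
have slope_n : fp_slope s w n = n * (w * wsum s (fun=> 1) n).
  rewrite /fp_slope -{1}n_rootE -mulrBr -sumrB [RHS]mulrCA /wsum [in RHS]mulr_sumr.
  congr (_ * _).
  by apply: eq_bigr => i _; field; rewrite gt_eqF.
have : 0 < w * wsum s (fun=> 1) n.
  by rewrite mulr_gt0// wsum_gt0//; exists (Ordinal p_gt0).
rewrite /v /fp_v slope_n; move: (w * _) => x x0.
by field; rewrite !gt_eqF.
Qed.

(** Clearing the denominator and writing [n] as [w sum n s / (s + n)] reduces the claim to [key_gt]
    times [s i], term by term. *)
Let v_m : n <= m ^+ 2 * v m.
Proof.
rewrite /v /fp_v mulrA ler_pdivlMr// /fp_slope mulrBr mulr1 lerBlDr.
rewrite /wsum mulrCA [n * (w * _)]mulrCA -mulrDr -[leLHS]mulr1 -{1}n_rootE mulrCA.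
rewrite ler_pM2l// !mulr_sumr -big_split; apply: ler_sum => i _ /=.
have -> : m ^+ 2 * (1 * (s i / (s i + m) ^+ 2)) + n * (s i / (s i + m)) ^+ 2 =
    s i * ((n * s i + m ^+ 2) / (s i + m) ^+ 2) by field; rewrite gt_eqF.
by rewrite mulrCA ler_pM2l// ltW.
Qed.

Lemma est_risk_lt : est_risk n < est_risk m.
Proof.
have v_lt : v n < v m.
  rewrite v_n -(ltr_pM2l (exprn_gt0 2 m_gt0)).
  apply: lt_le_trans v_m; by rewrite ltr_pdivrMr// -expr2 ltr_pXn2r// nnegrE ltW.
have riskE x : est_risk x =
    \sum_i b i * ((x ^+ 2 * v x * s i + x ^+ 2) / (s i + x) ^+ 2) + sg * v x.
  rewrite /est_risk /wsum !mulr_sumr -big_split mulr_sumr; congr (_ + _).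
  by apply: eq_bigr => i _ /=; ring.
have term_n i : (n ^+ 2 * v n * s i + n ^+ 2) / (s i + n) ^+ 2 = n / (s i + n).
  by rewrite v_n; field; rewrite !gt_eqF.
(* By [v_m], [m^2 v m] may be lowered to [n] in the numerator, where [key_gt] applies. *)
have term i : n / (s i + n) < (m ^+ 2 * v m * s i + m ^+ 2) / (s i + m) ^+ 2.
  apply: lt_le_trans (key_gt i) _.
  by rewrite ler_pM2r ?invr_gt0 ?exprn_gt0// lerD2r ler_pM2r.
rewrite !riskE; under eq_bigr do rewrite term_n.
(* Strictness comes from a direction with [b k > 0], or from the noise through [v_lt]. *)
case: nontrivial => [[k bk]|sg0]; last first.
  apply: ler_ltD; last by rewrite ltr_pM2l.
  by apply: ler_sum => i _; rewrite ler_wpM2l// ltW.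
apply: ltr_leD; last by rewrite ler_wpM2l// ltW.
rewrite (bigD1 k)//= [ltRHS](bigD1 k)//= ltr_leD ?ltr_pM2l//.
by apply: ler_sum => i _; rewrite ler_wpM2l// ltW.
Qed.

End Comparison.
End EstimationRisk.

(** * Isotropic features: the risk as a function of [u] *)

Section IsotropicRisk.
Variables (R : realFieldType) (r a B Q sg : R).
Hypotheses (r_gt0 : 0 < r) (r_lt1 : r < 1).
Hypotheses (a_ge0 : 0 <= a) (B_ge0 : 0 <= B) (sg_ge0 : 0 <= sg).
Hypothesis gap : a * B + a * sg / (1 - r) ^+ 3 < Q.

(* [vtilde] for [Sigma = I], in the variables [u = 1 / (1 + m)], [r = 1 / phi]
   and [a = trbar Sigma0]. *)
Definition iso_v (u : R) : R := a * (u ^+ 2 / (r - u ^+ 2)).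

(** [1 - u] is [m / (1 + m)]; [B] and [Q] stand for the quadratic forms of the identity and of
    [Sigma0] at [beta]. *)
Definition iso_risk (u : R) : R := (1 - u) ^+ 2 * (iso_v u * B + Q) + sg * iso_v u.

(** As weights of [(1 - u)^2], [a B] turns the signal term into [a B r (1 - u)^2 / (r - u^2)], and
    [a sg / (1 - r)^3] cancels the derivative of [sg * iso_v] at [r]; both resulting terms are
    stationary at [u = r]. *)
Let eta := Q - (a * B + a * sg / (1 - r) ^+ 3).

Let excess (u : R) := (u - r) ^+ 2 / (r - u ^+ 2) *
  (a * B + a * sg * (1 + r - r ^+ 2 + 2 * (1 - r) * u - u ^+ 2) / (1 - r) ^+ 3).

(* [excess] is what the two terms minimal at [u = r] gain over their minima. *)
Let iso_risk_split u : u ^+ 2 < r ->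
  iso_risk u = iso_risk r + eta * ((1 - u) ^+ 2 - (1 - r) ^+ 2) + excess u.
Proof.
move=> ur; rewrite /iso_risk /iso_v /eta /excess.
have rr : r ^+ 2 < r by rewrite expr2 gtr_pMl.
by field; rewrite !gt_eqF ?subr_gt0.
Qed.

(** Larger [u] means smaller [lambda], so [u1] stands for a negative one. With [e = u1 - r], the
    [eta] term drops by at least [eta e t], while [excess] is at most [e^2 M]. *)
Lemma iso_risk_right : exists u1, [/\ r < u1, u1 ^+ 2 < r &
  forall u, 0 <= u <= r -> iso_risk u1 < iso_risk u].
Proof.
have eta0 : 0 < eta by rewrite subr_gt0.
pose t := 1 - r; have t0 : 0 < t by rewrite subr_gt0.
(* [2 / (r t)] will bound [1 / (r - u1^2)], and [4] the polynomial factor in [excess]. *)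
pose M := 2 / (r * t) * (a * B + a * sg * 4 / t ^+ 3).
have M0 : 0 <= M.
  by rewrite !mulr_ge0// ?invr_ge0 ?addr_ge0 ?mulr_ge0// ?invr_ge0 ?exprn_ge0 ?mulr_ge0// ltW.
(* The first bound keeps [r - u1^2] above [r t / 2], the second gives [e^2 M < eta e t]. *)
pose e := Num.min (r * t / 6) (eta * t / (M + 1)).
have e0 : 0 < e.
  by rewrite lt_min !divr_gt0 ?mulr_gt0// ltr_wpDl.
have e1 : e <= r * t / 6 by rewrite ge_min lexx.
have e2 : e * (M + 1) <= eta * t.
  by rewrite -ler_pdivlMr ?ltr_wpDl// ge_min lexx orbT.
have rt1 : r + t = 1 by rewrite /t addrCA subrr addr0.
pose u1 := r + e.
have u1r : r * t / 2 <= r - u1 ^+ 2 by rewrite /u1; nra.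
have u1r' : u1 ^+ 2 < r.
  by rewrite -subr_gt0; apply: lt_le_trans u1r; rewrite divr_gt0 ?mulr_gt0.
have lt_r : iso_risk u1 < iso_risk r.
  have u1E : (1 - u1) ^+ 2 - (1 - r) ^+ 2 <= - (e * t).
    by rewrite /u1; nra.
  have ex : excess u1 <= e ^+ 2 * M.
    have -> : e ^+ 2 * M = (u1 - r) ^+ 2 * (2 / (r * t)) * (a * B + a * sg * 4 / t ^+ 3).
      by rewrite /M /u1; ring.
    rewrite /excess; apply: ler_pM.
    - by rewrite divr_ge0 ?sqr_ge0// subr_ge0 ltW.
    - rewrite addr_ge0 ?mulr_ge0 ?invr_ge0 ?exprn_ge0 ?(ltW t0)//.
      by rewrite /u1; nra.
    - rewrite ler_wpM2l ?sqr_ge0//.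
      have -> : 2 / (r * t) = (r * t / 2)^-1 by field; rewrite !gt_eqF.
      by rewrite lef_pV2 ?posrE ?divr_gt0 ?mulr_gt0// subr_gt0.
    - rewrite lerD2l ler_wpM2r ?invr_ge0 ?exprn_ge0 ?(ltW t0)//.
      by rewrite ler_wpM2l ?mulr_ge0// /u1; nra.
  rewrite iso_risk_split// -addrA gtrDl.
  have : eta * ((1 - u1) ^+ 2 - (1 - r) ^+ 2) <= eta * - (e * t).
    by rewrite ler_pM2l.
  nra.
exists u1; split; [by rewrite ltrDl|by []|move=> u /andP[u0 ur]].
(* For [0 <= u <= r] both the [eta] term and [excess] are nonnegative, so [iso_risk r] is the
   minimum there. *)
apply: lt_le_trans lt_r _.
have u2r : u ^+ 2 < r by nra.
rewrite [leRHS]iso_risk_split// -addrA lerDl addr_ge0//.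
  by rewrite mulr_ge0 ?(ltW eta0)//; nra.
rewrite /excess mulr_ge0 ?divr_ge0 ?sqr_ge0 ?subr_ge0 ?(ltW u2r)//.
rewrite addr_ge0 ?mulr_ge0 ?invr_ge0 ?exprn_ge0 ?(ltW t0)//.
nra.
Qed.

End IsotropicRisk.

(** * Reduction to the eigenbasis *)

Section OrthogonalDiagonal.
Variables (R : realType) (p : nat) (P : 'M[R]_p).
Hypothesis PP : P *m P^T = 1%:M.

(** Functions of [Sigma] in a fixed eigenbasis: products and resolvents keep this form, so matrix
    identities become entrywise ones on [d]. *)
Definition spectral_mx (d : 'rV[R]_p) : 'M[R]_p := P^T *m diag_mx d *m P.

Let PtP : P^T *m P = 1%:M. Proof. exact: mulmx1C PP. Qed.

Lemma tr_spectral_mx d : (spectral_mx d)^T = spectral_mx d.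
Proof. by rewrite /spectral_mx !trmx_mul trmxK tr_diag_mx mulmxA. Qed.

Lemma spectral_mxM d e :
  spectral_mx d *m spectral_mx e = spectral_mx (\row_i (d 0 i * e 0 i)).
Proof.
by rewrite /spectral_mx !mulmxA -(mulmxA _ P) PP mulmx1 -(mulmxA P^T) mulmx_diag.
Qed.

Lemma spectral_mxD_scalar d m :
  spectral_mx d + m%:M = spectral_mx (\row_i (d 0 i + m)).
Proof.
have -> : \row_i (d 0 i + m) = d + const_mx m by apply/rowP => i; rewrite !mxE.
rewrite /spectral_mx raddfD /= diag_const_mx mulmxDr mulmxDl mul_mx_scalar.
by rewrite -scalemxAl PtP scalemx1.
Qed.

Lemma spectral_mx1 : spectral_mx (const_mx 1) = 1%:M.
Proof. by rewrite /spectral_mx diag_const_mx mulmx1. Qed.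

Lemma resolvent_spectral (d : 'rV[R]_p) m : (forall i, 0 < d 0 i + m) ->
  resolvent (spectral_mx d) m = spectral_mx (\row_i (d 0 i + m)^-1).
Proof.
move=> dm; rewrite /resolvent spectral_mxD_scalar.
have XY : spectral_mx (\row_i (d 0 i + m)) *m spectral_mx (\row_i (d 0 i + m)^-1) = 1%:M.
  rewrite spectral_mxM -spectral_mx1; congr spectral_mx.
  by apply/rowP => i; rewrite !mxE divff// gt_eqF.
have [Xu _] := mulmx1_unit XY.
by rewrite -[LHS]mulmx1 -XY mulKmx.
Qed.

(** Only the diagonal of [A] in the eigenbasis enters, even if [A] does not commute with the
    spectral matrix; this is how [vtilde] sees [Sigma0]. *)
Lemma mxtrace_mul_spectral A d :
  \tr (A *m spectral_mx d) = \sum_i (P *m A *m P^T) i i * d 0 i.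
Proof.
rewrite /spectral_mx !mulmxA mxtrace_mulC !mulmxA mxtrace_mulC.
by rewrite /mxtrace; apply: eq_bigr => i _; rewrite mul_diag_mx mxE mulrC.
Qed.

Lemma mxtrace_spectral d : \tr (spectral_mx d) = \sum_i d 0 i.
Proof.
rewrite -[spectral_mx d]mul1mx mxtrace_mul_spectral mulmx1 PP.
by apply: eq_bigr => i _; rewrite mxE eqxx mul1r.
Qed.

Lemma bilin_spectral v d :
  bilin v (spectral_mx d) v = \sum_i (P *m v) i 0 ^+ 2 * d 0 i.
Proof.
rewrite /bilin /spectral_mx !mulmxA -(mulmxA _ P) -trmx_mul -mulmxA mul_diag_mx.
rewrite mxE; apply: eq_bigr => i _.
by rewrite [_^T _ _]mxE [X in _ * X]mxE expr2 mulrCA mulrC.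
Qed.

Lemma orthogonal_mul_neq0 (v : 'cV[R]_p) : v != 0 -> exists i, (P *m v) i 0 != 0.
Proof.
move=> v0; apply/existsP; rewrite -negb_forall; apply: contra v0 => /forallP Pv.
rewrite -[v]mul1mx -PtP -mulmxA (_ : P *m v = 0) ?mulmx0//.
by apply/colP => i; rewrite [RHS]mxE; exact/eqP.
Qed.

Lemma eigenvalue_spectral d a : eigenvalue (spectral_mx d) a <-> exists i, d 0 i = a.
Proof.
split=> [/eigenvalueP[v vA v0]|[i <-]].
  have [|i vi] := @orthogonal_mul_neq0 v^T; first by rewrite trmx_eq0.
  exists i; apply: (mulIf vi).
  have /(congr1 (fun A => (A *m P^T) 0 i)) := vA.
  have -> : (P *m v^T) i 0 = (v *m P^T) 0 i.
    by rewrite -[P in LHS]trmxK -trmx_mul [LHS]mxE.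
  rewrite /= /spectral_mx !mulmxA -(mulmxA _ P P^T) PP mulmx1 -scalemxAl.
  by move: (v *m P^T) => x; rewrite mul_mx_diag !mxE mulrC.
apply/eigenvalueP; exists (row i P).
  rewrite /spectral_mx !mulmxA -row_mul PP -row_mul mul1mx row_diag_mx.
  by rewrite -scalemxAl -rowE.
apply/eqP => Pi; have /matrixP/(_ i i) := PP.
rewrite mxE big1 ?mxE ?eqxx => [/eqP|j _]; first by rewrite eq_sym oner_eq0.
by move/rowP/(_ j): Pi; rewrite !mxE => ->; rewrite mul0r.
Qed.

End OrthogonalDiagonal.

Lemma bilin_gt0 (R : realType) p (c C : R) (A : 'M[R]_p) (v : 'cV[R]_p) :
  0 < c -> A^T = A -> spectrum_in A c C -> v != 0 -> 0 < bilin v A v.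
Proof.
move=> c0 /symmetric_spectral[P [d [PP AE]]] Ac v0.
have -> : A = spectral_mx P d by [].
have dP i : 0 < d 0 i.
  apply: (lt_le_trans c0); have /Ac/andP[] // : eigenvalue A (d 0 i).
  by rewrite AE; apply/(eigenvalue_spectral PP); exists i.
have [i vi] := orthogonal_mul_neq0 PP v0.
rewrite bilin_spectral// (bigD1 i)//= ltr_pwDl//.
  by rewrite mulr_gt0// exprn_even_gt0.
by apply: sumr_ge0 => j _; rewrite mulr_ge0 ?sqr_ge0// ltW.
Qed.

Section ScalarReduction.
Variables (R : realType) (p : nat) (P : 'M[R]_p) (d : 'rV[R]_p) (phi : R).
Hypotheses (PP : P *m P^T = 1%:M) (p_gt0 : (0 < p)%N).
Hypotheses (d_gt0 : forall i, 0 < d 0 i) (phi_gt0 : 0 < phi).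

Let S := spectral_mx P d.
Let s i := d 0 i.
Let w := phi / p%:R.

Let p0 : 0 < p%:R :> R. Proof. by rewrite ltr0n. Qed.
Let w_gt0 : 0 < w. Proof. exact: divr_gt0. Qed.

Lemma rmin_lt m : - rmin S < m <-> fp_dom s m.
Proof.
have E a : eigenvalue S a <-> exists i, d 0 i = a by exact: eigenvalue_spectral.
have lb : lbound [set a | eigenvalue S a] 0.
  by move=> a /= /E[i <-]; rewrite ltW.
split=> [m0 i|md].
  rewrite -ltrBlDr sub0r; apply: (@lt_le_trans _ _ (rmin S)); first by rewrite ltrNl.
  by apply: ge_inf; [exists 0|apply/E; exists i].
pose i0 := Ordinal p_gt0.
case: (@arg_minP _ _ _ i0 predT s isT) => k _ kmin.
rewrite ltrNl; apply: (@lt_le_trans _ _ (s k)).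
  by have := md k; rewrite -ltrBlDr sub0r.
apply: lb_le_inf; first by exists (s k); apply/E; exists k.
by move=> a /= /E[i <-]; exact: kmin.
Qed.

Lemma slope_trbar m : fp_dom s m ->
  1 - phi * trbar (S ^+ 2 *m resolvent S m ^+ 2) = fp_slope s w m.
Proof.
move=> md; rewrite resolvent_spectral// !expr2 !mulmxE -/S.
rewrite -!mulmxE !spectral_mxM// /trbar mxtrace_spectral// /fp_slope.
rewrite /w mulrA mulrAC; congr (_ - _ * _).
by apply: eq_bigr => i _; rewrite !mxE expr_div_n !expr2 invfM.
Qed.

Lemma lambda_trbar m : fp_dom s m ->
  m - phi * trbar (m *: (S *m resolvent S m)) = fp_lambda s w m.
Proof.
move=> md; rewrite resolvent_spectral// spectral_mxM// /trbar mxtraceZ.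
rewrite mxtrace_spectral// /fp_lambda -mulr_sumr /w mulrA mulrAC.
congr (_ - _ * (_ * _)).
by apply: eq_bigr => i _; rewrite !mxE.
Qed.

(** [xget] meets its predicate once the set is inhabited, which [fp_slope_root] ensures. *)
Lemma mu_min_spec : fp_dom s (mu_min S phi) /\ fp_slope s w (mu_min S phi) = 0.
Proof.
have [|m1 m2] := @xgetPex _ 0 [set m : R | - rmin S < m /\
    1 = phi * trbar (S ^+ 2 *m resolvent S m ^+ 2)].
  have [m [md m0]] := fp_slope_root p_gt0 d_gt0 w_gt0.
  exists m; split; first exact/rmin_lt.
  by apply/eqP; rewrite -subr_eq0 slope_trbar// m0.
have md : fp_dom s (mu_min S phi) by exact/rmin_lt.
by split=> //; apply/eqP; rewrite -slope_trbar// subr_eq0; exact/eqP.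
Qed.

Lemma mu_min_dom m : mu_min S phi <= m -> fp_dom s m.
Proof. by have [md _] := mu_min_spec; exact: fp_domW. Qed.

Lemma lambda_min_fp : lambda_min S phi = fp_lambda s w (mu_min S phi).
Proof. by rewrite -lambda_trbar//; exact: mu_min_dom. Qed.

Lemma mu_spec l : lambda_min S phi < l ->
  mu_min S phi < mu S l phi /\ fp_lambda s w (mu S l phi) = l.
Proof.
rewrite lambda_min_fp => hl.
have [|m1 m2] := @xgetPex _ 0 [set m : R | mu_min S phi < m /\
    m = l + phi * trbar (m *: (S *m resolvent S m))].
  have [md _] := mu_min_spec.
  have [m mlt <-] := fp_lambda_surj d_gt0 w_gt0 md hl.
  exists m; split=> //=.
  by rewrite -lambda_trbar ?subrK//; apply: mu_min_dom; exact: ltW.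
split=> //; rewrite -lambda_trbar; last by apply: mu_min_dom; exact: ltW.
by rewrite [X in X - _]m2 addrK.
Qed.

Lemma mu_slope_gt0 m : mu_min S phi < m -> 0 < fp_slope s w m.
Proof.
move=> mlt; have [md <-] := mu_min_spec; exact: fp_slope_lt.
Qed.

(** The slope vanishes at [mu_min] and is positive beyond, so comparisons of [lambda] and of [mu]
    are interchangeable. *)
Lemma fp_lambda_ltE x y : mu_min S phi <= x -> mu_min S phi <= y ->
  (fp_lambda s w x < fp_lambda s w y) = (x < y).
Proof.
have [md m0] := mu_min_spec.
have mono a b : mu_min S phi <= a -> a < b -> fp_lambda s w a < fp_lambda s w b.
  rewrite le_eqVlt => /orP[/eqP <-|ha] ab; apply: fp_lambda_lt => //.
  - by rewrite m0.
  - exact: mu_min_dom (ltW ha).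
  - exact/ltW/mu_slope_gt0.
move=> hx hy; case: (ltgtP x y) => [xy|yx|->]; last by rewrite ltxx.
  by rewrite mono.
by apply/negbTE; rewrite -leNgt ltW// mono.
Qed.

Lemma mu_fp m : mu_min S phi < m -> mu S (fp_lambda s w m) phi = m.
Proof.
move=> hm; have [|h1 h2] := @mu_spec (fp_lambda s w m).
  by rewrite lambda_min_fp fp_lambda_ltE// ltW.
apply/eqP; rewrite eq_le !leNgt -(fp_lambda_ltE (ltW h1) (ltW hm)).
by rewrite -(fp_lambda_ltE (ltW hm) (ltW h1)) h2 ltxx.
Qed.

Variables (S0 : 'M[R]_p) (beta : 'cV[R]_p).
Let t i := (P *m S0 *m P^T) i i.
Let b i := (P *m beta) i 0 ^+ 2.

Lemma vtilde_fp l : lambda_min S phi < l ->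
  vtilde S S0 l phi = fp_v s t w (mu S l phi).
Proof.
move=> /mu_spec[hm _]; have md := mu_min_dom (ltW hm).
rewrite /vtilde slope_trbar// /fp_v; congr (_ / _).
rewrite resolvent_spectral// expr2 -mulmxE -mulmxA !spectral_mxM//.
rewrite /trbar mxtrace_mul_spectral /w mulrA mulrAC; congr (_ * _).
rewrite /wsum; apply: eq_bigr => i _; congr (_ * _).
by rewrite !mxE -invfM expr2.
Qed.

(** The [Sigma] part is diagonal in the eigenbasis; the [Sigma0] part stays a quadratic form, since
    [Sigma0] need not commute with [Sigma]. *)
Lemma risk_bias_fp l : lambda_min S phi < l ->
  risk_bias S S0 beta l phi = let m := mu S l phi in
  m ^+ 2 * (fp_v s t w m * wsum s b m
            + bilin (resolvent S m *m beta) S0 (resolvent S m *m beta)).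
Proof.
move=> hl; have [hm _] := mu_spec hl; have md := mu_min_dom (ltW hm).
rewrite /risk_bias vtilde_fp//; cbv zeta; congr (_ * _).
set m := mu S l phi in hm md *; set v := fp_v _ _ _ _.
have Gs : (resolvent S m)^T = resolvent S m.
  by rewrite resolvent_spectral// tr_spectral_mx.
rewrite mulmxDr mulmxDl {1}/bilin mulmxDr mulmxDl mxE; congr (_ + _); last first.
  by rewrite /bilin trmx_mul Gs !mulmxA.
rewrite -scalemxAr -!scalemxAl -scalemxAr -scalemxAl mxE; congr (_ * _).
rewrite -/(bilin _ _ _) resolvent_spectral// !spectral_mxM// bilin_spectral//.
rewrite /wsum; apply: eq_bigr => i _; congr (_ * _).
by rewrite !mxE /s; field; rewrite gt_eqF.
Qed.

Lemma risk_fp l sigma2 sigma02 : lambda_min S phi < l ->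
  risk S S0 beta beta sigma2 sigma02 l phi = (let m := mu S l phi in
  m ^+ 2 * (fp_v s t w m * wsum s b m
            + bilin (resolvent S m *m beta) S0 (resolvent S m *m beta)))
  + sigma2 * fp_v s t w (mu S l phi) + sigma02.
Proof.
move=> hl; rewrite /risk risk_bias_fp// /risk_var vtilde_fp//.
have bilin0 A v : bilin v A 0 = 0 by rewrite /bilin mulmx0 mxE.
by rewrite /risk_shift /risk_irr subrr !bilin0 mulr0 addr0 add0r.
Qed.

End ScalarReduction.

(** * Location of the minimizer *)

Section NegativeRegularization.
Variables (R : realType) (c C : R) (p : nat) (P : 'M[R]_p) (d : 'rV[R]_p).
Variables (S0 : 'M[R]_p) (beta : 'cV[R]_p) (sigma2 sigma02 phi : R).
Hypotheses (PP : P *m P^T = 1%:M) (p_gt0 : (0 < p)%N).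
Hypotheses (d_gt0 : forall i, 0 < d 0 i) (phi_gt0 : 0 < phi).
Hypotheses (c_gt0 : 0 < c) (S0s : S0^T = S0) (S0c : spectrum_in S0 c C).
Hypotheses (sigma2_ge0 : 0 <= sigma2) (nontrivial : beta <> 0 \/ 0 < sigma2).

Let S := spectral_mx P d.
Let s i := d 0 i.
Let w := phi / p%:R.
Let t i := (P *m S0 *m P^T) i i.
Let b i := (P *m beta) i 0 ^+ 2.

Let p0 : 0 < p%:R :> R. Proof. by rewrite ltr0n. Qed.
Let w_gt0 : 0 < w. Proof. exact: divr_gt0. Qed.

Let t_gt0 i : 0 < t i.
Proof.
have -> : t i = bilin (row i P)^T S0 (row i P)^T.
  rewrite /t /bilin trmxK -row_mul; move: (P *m S0) => X; rewrite !mxE.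
  by apply: eq_bigr => j _; rewrite !mxE.
apply: bilin_gt0 c_gt0 S0s S0c _; apply/eqP => /(congr1 trmx).
rewrite trmxK trmx0 => Pi; have /matrixP/(_ i i) := PP.
rewrite mxE big1 ?mxE ?eqxx => [/eqP|j _]; first by rewrite eq_sym oner_eq0.
by move/rowP/(_ j): Pi; rewrite !mxE => ->; rewrite mul0r.
Qed.

Let bilin_ge0 v : 0 <= bilin v S0 v.
Proof.
have [->|v0] := eqVneq v 0; first by rewrite /bilin mulmx0 mxE.
exact/ltW/(bilin_gt0 c_gt0 S0s S0c v0).
Qed.

Let b_ge0 i : 0 <= b i. Proof. exact: sqr_ge0. Qed.

Let b_nontrivial : (exists i, 0 < b i) \/ 0 < sigma2.
Proof.
case: nontrivial => [/eqP b0|]; [left|by right].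
have [i Pi] := orthogonal_mul_neq0 PP b0; exists i.
by rewrite exprn_even_gt0.
Qed.

Let f (x : R) : \bar R := (risk S S0 beta beta sigma2 sigma02 x phi)%:E.

Lemma mu_min_neq0 : phi != 1 -> mu_min S phi != 0.
Proof.
move=> phi1; have [_] := mu_min_spec PP p_gt0 d_gt0 phi_gt0.
move=> ms; apply/eqP => m0; move: ms.
rewrite m0 fp_slope0// divfK ?gt_eqF// => /eqP.
by rewrite subr_eq0 eq_sym (negPf phi1).
Qed.

Lemma lambda_min_lt0 : phi != 1 -> lambda_min S phi < 0.
Proof.
move=> /mu_min_neq0 mu0; have [md ms] := mu_min_spec PP p_gt0 d_gt0 phi_gt0.
by rewrite lambda_min_fp// fp_lambda_root_slope.
Qed.

(** The nonnegative [Sigma0] form is dropped and [fp_v_blowup] applies to the rest, with [sigma02]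
    absorbed in the threshold. *)
Lemma risk_cvg_lambda_min : phi != 1 ->
  f x @[x --> (lambda_min S phi)^'+] --> +oo%E.
Proof.
move=> phi1; apply/cvgeyPge => A.
have [md ms] := mu_min_spec PP p_gt0 d_gt0 phi_gt0.
have [y my yP] := fp_v_blowup p_gt0 d_gt0 w_gt0 t_gt0 b_ge0 sigma2_ge0
  b_nontrivial (A - sigma02) md ms (mu_min_neq0 phi1).
have ly : lambda_min S phi < fp_lambda s w y.
  by rewrite lambda_min_fp// (fp_lambda_ltE PP)// ltW.
near=> l.
have hl : lambda_min S phi < l by near: l; exact: nbhs_right_gt.
have lly : l < fp_lambda s w y by near: l; exact: nbhs_right_lt.
have [hm mE] := mu_spec PP p_gt0 d_gt0 phi_gt0 hl.
rewrite lee_fin risk_fp// -lerBlDr; apply: le_trans (yP (mu S l phi) _) _.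
  by rewrite hm -(fp_lambda_ltE PP p_gt0 d_gt0 phi_gt0 (ltW hm) (ltW my)) mE.
by cbv zeta; rewrite lerD2r ler_wpM2l ?sqr_ge0// lerDl.
Unshelve. all: by end_near. Qed.

(** A negative candidate loses to [0]: by hypothesis above [lambda_min], and at [lambda_min] because
    the extended risk is [+oo] there. *)
Lemma argmin_ge0 l : phi != 1 ->
  (forall x, lambda_min S phi < x -> x < 0 -> (f 0 < f x)%E) ->
  risk_argmin S S0 beta beta sigma2 sigma02 phi l -> (0 <= l)%E.
Proof.
move=> phi1 fP [ml lmin]; rewrite leNgt; apply/negP => l0.
have m0 := lambda_min_lt0 phi1.
have := lmin (0 : R)%:E; rewrite lee_fin ltW// => /(_ isT); rewrite /risk_ext.
rewrite (gt_eqF m0).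
case: l ml l0 {lmin} => [r| |]//; rewrite lee_fin lte_fin => mr r0.
have [rE|rm] := eqVneq; last first.
  by rewrite leNgt fP// lt_neqAle eq_sym rm.
by rewrite (cvg_lim _ (risk_cvg_lambda_min phi1)).
Qed.

Lemma risk0_lt_underparameterized x :
  phi < 1 -> lambda_min S phi < x -> x < 0 -> (f 0 < f x)%E.
Proof.
move=> phi1 hx x0; have l0 := lambda_min_lt0 (negbT (lt_eqF phi1)).
have [md ms] := mu_min_spec PP p_gt0 d_gt0 phi_gt0.
(* The slope increases and equals [1 - phi > 0] at [0], so its root is negative; [mu S 0 phi] is
   then [0], which cancels the bias. *)
have mu0 : mu_min S phi < 0.
  rewrite ltNge; apply/negP => hm.
  have : 0 < fp_slope s w 0 by rewrite fp_slope0// divfK ?gt_eqF// subr_gt0.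
  move: hm; rewrite le_eqVlt => /orP[/eqP E|/(fp_slope_lt p_gt0 d_gt0 w_gt0 (fp_dom0 d_gt0))].
    by rewrite [X in fp_slope _ _ X]E ms ltxx.
  by rewrite ms => /lt_trans h /h; rewrite ltxx.
have m0 : mu S 0 phi = 0 by have := mu_fp PP p_gt0 d_gt0 phi_gt0 mu0; rewrite fp_lambda0.
have [hm mE] := mu_spec PP p_gt0 d_gt0 phi_gt0 hx.
have mx0 : mu S x phi < 0.
  by rewrite -(fp_lambda_ltE PP p_gt0 d_gt0 phi_gt0 (ltW hm) (ltW mu0)) mE fp_lambda0.
rewrite lte_fin !risk_fp//= m0 expr0n/= mul0r add0r ltrD2r.
set m := mu S x phi in hm mE mx0 *.
have xd : fp_dom s m := mu_min_dom PP p_gt0 d_gt0 phi_gt0 (ltW hm).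
have xs : 0 < fp_slope s w m := mu_slope_gt0 PP p_gt0 d_gt0 phi_gt0 hm.
have vlt := fp_v_lt p_gt0 d_gt0 w_gt0 t_gt0 xd xs mx0.
have v0 := fp_v_gt0 p_gt0 d_gt0 w_gt0 t_gt0 xd xs.
have m2 : 0 < m ^+ 2 by rewrite exprn_even_gt0//= (lt_eqF mx0).
(* Strictness comes from the positive bias if [beta] is nonzero, from the larger variance if there
   is noise. *)
case: b_nontrivial => [ib|sg]; last first.
  apply: ltr_wpDl; last by rewrite ltr_pM2l.
  by rewrite mulr_ge0 ?sqr_ge0// addr_ge0// mulr_ge0 ?(ltW v0)// wsum_ge0.
apply: ltr_pwDl; last by rewrite ler_wpM2l// ltW.
by rewrite mulr_gt0// ltr_pwDl// mulr_gt0// wsum_gt0.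
Qed.

Lemma risk0_lt_overparameterized x : S0 = 1%:M ->
  1 < phi -> lambda_min S phi < x -> x < 0 -> (f 0 < f x)%E.
Proof.
move=> S01 phi1 hx x0; have l0 := lambda_min_lt0 (negbT (gt_eqF phi1)).
have [md ms] := mu_min_spec PP p_gt0 d_gt0 phi_gt0.
have t1 : t = fun=> 1.
  by apply/funext => i; rewrite /t S01 mulmx1 PP mxE eqxx.
(* Now the slope at [0] is [1 - phi < 0], so its root is positive and [est_risk_lt] compares
   positive values of [mu]. *)
have mu0 : 0 < mu_min S phi.
  rewrite ltNge; apply/negP => hm.
  have : fp_slope s w 0 < 0 by rewrite fp_slope0// divfK ?gt_eqF// subr_lt0.
  move: hm; rewrite le_eqVlt => /orP[/eqP E|/(fp_slope_lt p_gt0 d_gt0 w_gt0 md)].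
    by rewrite -[X in fp_slope _ _ X]E ms ltxx.
  by rewrite ms => /lt_trans h /h; rewrite ltxx.
have riskE y : lambda_min S phi < y ->
    f y = (est_risk s b w sigma2 (mu S y phi) + sigma02)%:E.
  move=> hy; rewrite /f risk_fp// -/t t1 /est_risk; congr ((_ * (_ + _) + _ + _)%:E).
  have [hm _] := mu_spec PP p_gt0 d_gt0 phi_gt0 hy.
  have yd := mu_min_dom PP p_gt0 d_gt0 phi_gt0 (ltW hm).
  rewrite {1}/bilin S01 mulmx1 trmx_mul resolvent_spectral// tr_spectral_mx.
  rewrite mulmxA -(mulmxA beta^T) spectral_mxM// -/(bilin _ _ _) bilin_spectral//.
  by apply: eq_bigr => i _; congr (_ * _); rewrite !mxE -invfM expr2.
have [hm mE] := mu_spec PP p_gt0 d_gt0 phi_gt0 hx.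
have [hn nE] := mu_spec PP p_gt0 d_gt0 phi_gt0 l0.
rewrite !riskE// lte_fin ltrD2r; apply: est_risk_lt => //.
- exact: lt_trans hm.
- by rewrite -(fp_lambda_ltE PP p_gt0 d_gt0 phi_gt0 (ltW hm) (ltW hn)) mE nE.
- exact: mu_slope_gt0 hm.
Qed.

End NegativeRegularization.

(** * The minimizer for isotropic features *)

Lemma iso_risk_cvg0 (R : realType) (r a B Q sg : R) : 0 < r ->
  iso_risk r a B Q sg u @[u --> 0] --> Q.
Proof.
move=> r0.
have sq : (u : R) ^+ 2 @[u --> 0] --> (0 : R).
  by rewrite -[X in _ --> X](mulr0 0); apply: cvgM; exact: cvg_id.
have v0 : iso_v r a u @[u --> 0] --> (0 : R).
  rewrite -[X in _ --> X](mulr0 a); apply: cvgM; first exact: cvg_cst.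
  rewrite -[X in _ --> X](mul0r (r - 0)^-1); apply: cvgM => //.
  apply: cvgV; first by rewrite subr0 gt_eqF.
  by apply: cvgB => //; exact: cvg_cst.
have QE : (1 - 0) * (1 - 0) * (0 * B + Q) + sg * 0 = Q by ring.
rewrite -[X in _ --> X]QE.
have one : 1 - (u : R) @[u --> 0] --> (1 - 0 : R).
  by apply: cvgB; [exact: cvg_cst|exact: cvg_id].
apply: cvgD; last by apply: cvgM => //; exact: cvg_cst.
apply: cvgM; first exact: (cvgM one one).
by apply: cvgD; [apply: cvgM => //|]; exact: cvg_cst.
Qed.

Section Isotropic.
Variables (R : realType) (c C : R) (p : nat) (S0 : 'M[R]_p) (beta : 'cV[R]_p).
Variables (sigma2 sigma02 phi : R).
Hypotheses (p_gt0 : (0 < p)%N) (phi_gt1 : 1 < phi).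

(** The identity is presented as a [spectral_mx], so that the reduction to the eigenbasis applies to
    it. *)
Let P : 'M[R]_p := 1%:M.
Let d : 'rV[R]_p := const_mx 1.
Let S := spectral_mx P d.

Let PP : P *m P^T = 1%:M. Proof. by rewrite trmx1 mulmx1. Qed.
Let d_gt0 i : 0 < d 0 i. Proof. by rewrite mxE. Qed.
Let phi_gt0 : 0 < phi. Proof. exact: lt_trans phi_gt1. Qed.

Let s i := d 0 i.
Let w := phi / p%:R.
Let t i := (P *m S0 *m P^T) i i.
Let b i := (P *m beta) i 0 ^+ 2.
Let p0 : p%:R != 0 :> R. Proof. by rewrite pnatr_eq0 -lt0n. Qed.

Let w_gt0 : 0 < w. Proof. by rewrite divr_gt0// ltr0n. Qed.

Let sE i : s i = 1. Proof. by rewrite /s mxE. Qed.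

Lemma iso_slope m : fp_slope s w m = 1 - phi * (1 + m)^-1 ^+ 2.
Proof.
rewrite /fp_slope; under eq_bigr do rewrite sE div1r.
rewrite sumr_const card_ord -[_ *+ p]mulr_natr /w; congr (_ - _).
by rewrite mulrCA divfK// mulrC.
Qed.

Lemma iso_lambda m : fp_lambda s w m = m * (1 - phi * (1 + m)^-1).
Proof.
rewrite /fp_lambda; under eq_bigr do rewrite sE div1r.
rewrite sumr_const card_ord -[_ *+ p]mulr_natr /w mulrBr mulr1; congr (_ - _).
by rewrite mulrCA divfK// -mulrA [_ * phi]mulrC.
Qed.

Lemma iso_vE m : 0 < 1 + m -> fp_v s t w m = iso_v phi^-1 (trbar S0) (1 + m)^-1.
Proof.
move=> m0; rewrite /fp_v iso_slope /iso_v /wsum.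
have -> : \sum_i t i * (s i / (s i + m) ^+ 2) = \tr S0 * (1 + m)^-1 ^+ 2.
  rewrite /mxtrace mulr_suml; apply: eq_bigr => i _.
  by rewrite sE /t mul1mx trmx1 mulmx1 exprVn div1r.
have -> : phi^-1 - (1 + m)^-1 ^+ 2 = phi^-1 * (1 - phi * (1 + m)^-1 ^+ 2).
  by rewrite mulrBr mulr1 mulKf// gt_eqF.
rewrite invfM invrK /w /trbar.
move: ((1 + m)^-1 ^+ 2) => x; move: (1 - _)^-1 p%:R^-1 => y z.
by ring.
Qed.

Lemma iso_riskE l : lambda_min S phi < l ->
  risk S S0 beta beta sigma2 sigma02 l phi =
  iso_risk phi^-1 (trbar S0) (bilin beta 1%:M beta) (bilin beta S0 beta) sigma2
    (1 + mu S l phi)^-1 + sigma02.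
Proof.
move=> hl; have [hm _] := mu_spec PP p_gt0 d_gt0 phi_gt0 hl.
have md := mu_min_dom PP p_gt0 d_gt0 phi_gt0 (ltW hm).
rewrite risk_fp//; cbv zeta; move: (mu _ _ _) => m in hm md *.
have m0 : 0 < 1 + m by have := md (Ordinal p_gt0); rewrite mxE.
rewrite iso_vE// /iso_risk; congr (_ + _ + _).
have -> : (1 - (1 + m)^-1) ^+ 2 = m ^+ 2 * (1 + m)^-1 ^+ 2.
  by field; rewrite gt_eqF.
rewrite -[RHS]mulrA; congr (_ * _); rewrite mulrDr mulrCA; congr (_ * _ + _).
  rewrite /wsum /bilin mulmx1 mxE mulr_sumr; apply: eq_bigr => i _.
  by rewrite mul1mx -/(s i) sE mxE div1r exprVn mulrC expr2.
rewrite resolvent_spectral//.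
have -> : spectral_mx P (\row_i (d 0 i + m)^-1) = (1 + m)^-1%:M.
  rewrite /spectral_mx trmx1 mul1mx mulmx1 -diag_const_mx; congr diag_mx.
  by apply/rowP => i; rewrite !mxE.
rewrite mul_scalar_mx /bilin -scalemxAr mxE [(_ *: _)^T]linearZ -!scalemxAl.
by rewrite [X in _ * X]mxE mulrA expr2.
Qed.

Hypotheses (c_gt0 : 0 < c) (S0s : S0^T = S0) (S0c : spectrum_in S0 c C).
Hypothesis sigma2_ge0 : 0 <= sigma2.

Lemma iso_argmin_lt0 l :
  let B := beta *m beta^T in
  let mu0 := mu S 0 phi in
  trbar S0 * (trbar B + (1 + mu0) ^+ 3 / mu0 ^+ 3 * sigma2) < trbar (S0 *m B) ->
  risk_argmin S S0 beta beta sigma2 sigma02 phi l -> (l < 0)%E.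
Proof.
set mu0 := mu S 0 phi => /= gap [ml lmin].
have l0 : lambda_min S phi < 0.
  by apply: lambda_min_lt0 => //; rewrite gt_eqF.
have [h0 mu0E] := mu_spec PP p_gt0 d_gt0 phi_gt0 l0.
have [md ms] := mu_min_spec PP p_gt0 d_gt0 phi_gt0.
have dom m : mu_min S phi <= m -> 0 < 1 + m.
  by move=> /(mu_min_dom PP p_gt0 d_gt0 phi_gt0)/(_ (Ordinal p_gt0)); rewrite mxE.
have mu_min_gt0 : 0 < mu_min S phi.
  rewrite ltNge; apply/negP => hm.
  have mm := dom _ (lexx _); move/eqP: ms; rewrite iso_slope subr_eq0 => /eqP E.
  have : phi = (1 + mu_min S phi) ^+ 2.
    by rewrite -[RHS]mul1r {1}E; field; rewrite gt_eqF.
  by move: mm hm phi_gt1; move: (mu_min _ _) => m; nra.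
have mu0_gt0 : 0 < mu0 by exact: lt_trans h0.
(* A nonzero root of [fp_lambda] satisfies [1 + m = phi]: thus [lambda = 0] is [u = r]. *)
have mu0_phi : 1 + mu0 = phi.
  move/eqP: mu0E; rewrite iso_lambda mulf_eq0 -/S -/mu0 (gt_eqF mu0_gt0)/= subr_eq0.
  by move=> /eqP E; rewrite -[LHS]mul1r {1}E divfK// gt_eqF// dom// ltW.
pose r := phi^-1.
have r0 : 0 < r by rewrite invr_gt0.
have r1 : r < 1 by rewrite invf_lt1.
have tr0 : 0 <= trbar S0.
  rewrite /trbar divr_ge0 ?ler0n// /mxtrace sumr_ge0// => i _.
  have -> : S0 i i = bilin (delta_mx i 0) S0 (delta_mx i 0).
    by rewrite /bilin trmx_delta -rowE -colE !mxE.
  apply/ltW/(bilin_gt0 c_gt0 S0s S0c)/eqP => /matrixP/(_ i 0).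
  by rewrite !mxE !eqxx => /eqP; rewrite oner_eq0.
pose q := bilin beta S0 beta; pose bb := bilin beta 1%:M beta.
have bb0 : 0 <= bb.
  rewrite /bb /bilin mulmx1 mxE sumr_ge0// => i _.
  by rewrite mxE -expr2 sqr_ge0.
(* Multiplying the hypothesis by [p] undoes the normalization of the traces with [B] and yields
   [p >= 1] copies of the nonnegative noise term, of which one is kept. *)
have gap' : trbar S0 * bb + trbar S0 * sigma2 / (1 - r) ^+ 3 < q.
  have trB A : trbar (A *m (beta *m beta^T)) = bilin beta A beta / p%:R.
    rewrite /trbar mulmxA mxtrace_mulC mulmxA /bilin.
    by congr (_ / _); rewrite /mxtrace big_ord1.
  move: gap; rewrite -[beta *m _]mul1mx !trB mul1mx trB -/q -/bb.
  have -> : (1 + mu0) ^+ 3 / mu0 ^+ 3 = ((1 - r) ^+ 3)^-1.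
    rewrite mu0_phi -expr_div_n -exprVn; congr (_ ^+ 3).
    have -> : mu0 = phi - 1 by rewrite -mu0_phi addrC addKr.
    by rewrite /r; field; rewrite gt_eqF//= subr_eq0 gt_eqF.
  have k0 : 0 <= trbar S0 * sigma2 / (1 - r) ^+ 3.
    apply: divr_ge0; first exact: mulr_ge0.
    by apply: exprn_ge0; rewrite subr_ge0 ltW.
  rewrite ltr_pdivlMr ?ltr0n//; apply: le_lt_trans.
  have -> : trbar S0 * (bb / p%:R + (1 - r) ^- 3 * sigma2) * p%:R =
      trbar S0 * bb + trbar S0 * sigma2 / (1 - r) ^+ 3 * p%:R.
    by move: ((1 - r) ^+ 3)^-1 => k; field.
  by rewrite lerD2l ler_peMr// ler1n.
have [u1 [ru1 u1r u1P]] := iso_risk_right r0 r1 tr0 bb0 sigma2_ge0 gap'.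
have u1_gt0 : 0 < u1 by exact: lt_trans ru1.
(* Back from [u1] to [m1], then to [l1]: [u1^2 < r] says that the slope at [m1] is positive, which
   places [m1] above [mu_min]. *)
pose m1 := u1^-1 - 1.
have m1E : 1 + m1 = u1^-1 by rewrite /m1 addrC subrK.
have m1_slope : 0 < fp_slope s w m1.
  rewrite iso_slope m1E invrK subr_gt0 -(ltr_pM2l r0) mulrA mulVf ?gt_eqF//.
  by rewrite mul1r mulr1.
have hm1 : mu_min S phi < m1.
  rewrite ltNge; apply/negP; rewrite le_eqVlt => /orP[/eqP E|lt_m1].
    by move: m1_slope; rewrite E ms ltxx.
  have d1 : fp_dom s m1 by move=> i; rewrite sE m1E invr_gt0.
  have := fp_slope_lt p_gt0 d_gt0 w_gt0 d1 lt_m1.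
  rewrite ms => /lt_trans /(_ m1_slope).
  by rewrite ltxx.
pose l1 := fp_lambda s w m1.
have mul1 : mu S l1 phi = m1 by exact: mu_fp.
have hl1 : lambda_min S phi < l1.
  by rewrite lambda_min_fp// (fp_lambda_ltE PP)// ltW.
have l1E : risk_ext S S0 beta beta sigma2 sigma02 phi l1%:E =
    (iso_risk r (trbar S0) bb q sigma2 u1 + sigma02)%:E.
  by rewrite /risk_ext gt_eqF// iso_riskE// mul1 m1E invrK.
rewrite ltNge; apply/negP => l_ge0.
have := lmin l1%:E; rewrite lee_fin (ltW hl1) l1E => /(_ isT).
(* A finite [l >= 0] has [mu >= mu0], hence [0 <= u <= r]; [l = +oo] is the limit [u = 0]. Both lose
   to [u1]. *)
case: l l_ge0 {ml lmin} => [x| |]//.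
  rewrite lee_fin => x0; have hx := lt_le_trans l0 x0.
  have [hmx mxE] := mu_spec PP p_gt0 d_gt0 phi_gt0 hx.
  rewrite /risk_ext gt_eqF// iso_riskE// lee_fin lerD2r leNgt => /negP; apply.
  have x_gt0 : 0 < 1 + mu S x phi by exact/dom/ltW.
  apply: u1P; rewrite invr_ge0 ltW//= lef_pV2 ?posrE// -[leLHS]mu0_phi lerD2l.
  rewrite leNgt -(fp_lambda_ltE PP p_gt0 d_gt0 phi_gt0 (ltW hmx) (ltW h0)).
  by rewrite mxE mu0E -leNgt.
move=> _; rewrite /risk_ext.
have u_cvg : (1 + mu S x phi)^-1 @[x --> +oo] --> (0 : R).
  apply/gtr0_cvgV0.
    near=> x; have x0 : 0 < x by near: x; exact: nbhs_pinfty_gt.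
    have [hmx _] := mu_spec PP p_gt0 d_gt0 phi_gt0 (lt_trans l0 x0).
    exact/dom/ltW.
  (* As [fp_lambda m <= m] for [m > 0], [mu] at [x] is at least [x]. *)
  apply: (@ger_cvgy _ _ _ _ id) => //.
  near=> x; have x0 : 0 < x by near: x; exact: nbhs_pinfty_gt.
  have [hmx mxE] := mu_spec PP p_gt0 d_gt0 phi_gt0 (lt_trans l0 x0).
  have m0 := lt_trans mu_min_gt0 hmx.
  rewrite -[leLHS]mxE iso_lambda; apply: (@le_trans _ _ (mu S x phi)).
    by rewrite ler_piMr ?(ltW m0)// gerBl ltW// mulr_gt0// invr_gt0 dom// ltW.
  by rewrite lerDr.
have risk_cvg : risk S S0 beta beta sigma2 sigma02 x phi @[x --> +oo] --> q + sigma02.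
  apply: cvg_trans (_ : iso_risk r (trbar S0) bb q sigma2 (1 + mu S x phi)^-1
    + sigma02 @[x --> +oo] --> _).
    apply: near_eq_cvg; near=> x.
    have x0 : 0 < x by near: x; exact: nbhs_pinfty_gt.
    by rewrite iso_riskE// (lt_trans l0).
  apply: cvgD; last exact: cvg_cst.
  by apply: (cvg_comp _ _ u_cvg); exact: iso_risk_cvg0.
have -> : lim ((risk S S0 beta beta sigma2 sigma02 x phi)%:E @[x --> +oo%R]) = (q + sigma02)%:E.
  apply/cvg_lim => //; apply: cvg_EFin => //; exact: nearW.
rewrite lee_fin lerD2r leNgt => /negP; apply.
have := u1P 0; rewrite lexx ltW// => /(_ isT).
by rewrite /iso_risk /iso_v expr0n/= mul0r mulr0 subr0 expr1n mul0r mul1r add0r mulr0 addr0.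
Unshelve. all: by end_near. Qed.
End Isotropic.

Theorem theorem2 (R : realType) (c C : R) (hc : 0 < c)
  (p : nat) (Sigma Sigma0 : 'M[R]_p) (beta beta0 : 'cV[R]_p)
  (sigma2 sigma02 phi : R)
  (hSsym : Sigma^T = Sigma) (hSspec : spectrum_in Sigma c C)
  (hS0sym : Sigma0^T = Sigma0) (hS0spec : spectrum_in Sigma0 c C)
  (hsigma2 : 0 <= sigma2) (hsigma02 : 0 <= sigma02) (hphi : 0 < phi)
  (hne : Sigma0 <> Sigma) (hbeta : beta0 = beta)
  (lstar : \bar R)
  (hl : risk_argmin Sigma Sigma0 beta beta0 sigma2 sigma02 phi lstar) :
  [/\ phi < 1 -> beta <> 0 \/ 0 < sigma2 -> (0 <= lstar)%E,
      1 < phi -> Sigma0 = 1%:M -> beta <> 0 \/ 0 < sigma2 -> (0 <= lstar)%E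
    & 1 < phi -> Sigma = 1%:M ->
      let B := beta *m beta^T in
      let mu0 := mu Sigma 0 phi in
      trbar (Sigma0 *m B) >
        trbar Sigma0 * (trbar B + (1 + mu0) ^+ 3 / mu0 ^+ 3 * sigma2) ->
      (lstar < 0)%E].
Proof.
(* All matrices of size zero are equal, so [Sigma0 <> Sigma] forces [p > 0]. *)
have p_gt0 : (0 < p)%N.
  move: hne; case: {+}p Sigma Sigma0 {hSsym hSspec hS0sym hS0spec hl beta beta0 hbeta} => // A A0.
  by case; apply/matrixP => - [].
have phi_neq1 : phi < 1 \/ 1 < phi -> phi != 1.
  by case=> ?; [rewrite lt_eqF|rewrite gt_eqF].
rewrite hbeta in hl *; have [P [d [PP SE]]] := symmetric_spectral hSsym.
have d_gt0 i : 0 < d 0 i.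
  apply: (lt_le_trans hc); have /hSspec/andP[] // : eigenvalue Sigma (d 0 i).
  by rewrite SE; apply/(eigenvalue_spectral PP); exists i.
split=> [phi1 nontrivial|phi1 S01 nontrivial|phi1 S1 B mu0 gap].
- rewrite SE in hl; apply: (argmin_ge0 PP p_gt0 d_gt0 hphi hc hS0sym hS0spec
    hsigma2 nontrivial _ _ hl); first by apply: phi_neq1; left.
  by move=> x; exact: (risk0_lt_underparameterized _ PP p_gt0 d_gt0 hphi hc
    hS0sym hS0spec hsigma2 nontrivial).
- rewrite SE in hl; apply: (argmin_ge0 PP p_gt0 d_gt0 hphi hc hS0sym hS0spec
    hsigma2 nontrivial _ _ hl); first by apply: phi_neq1; right.
  by move=> x; exact: (risk0_lt_overparameterized _ PP p_gt0 d_gt0 hphi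
    hsigma2 nontrivial).
- have S1E : spectral_mx 1%:M (const_mx 1) = Sigma.
    by rewrite S1; apply: spectral_mx1; rewrite trmx1 mulmx1.
  rewrite -S1E in hl.
  apply: (iso_argmin_lt0 p_gt0 phi1 hc hS0sym hS0spec hsigma2 _ hl).
  by rewrite S1E.
Qed.
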